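(* Let $\Bbbk$ be a commutative ring with unit $1\neq 0$ and without zero divisors. Let $p(x)=x^n+c_1x^{n-1}+\dots+c_n\in\Bbbk[x]$ be a monic polynomial which has all roots in $\Bbbk$, i.e. $p(x)=(x-\alpha_1)^{\mu_1}(x-\alpha_2)^{\mu_2}\cdots(x-\alpha_k)^{\mu_k}$ with pairwise distinct $\alpha_1,\dots,\alpha_k\in\Bbbk$ and integers $\mu_1,\dots,\mu_k\ge 1$. Then the sequences $s(\alpha_u,a)$, where $1\le u\le k$ and $0\le a\le \mu_u-1$, are free generators of a free $\Bbbk$-submodule of $\operatorname{Ker} p(L)$.
   Context: $\mathfrak{S}_\Bbbk$ denotes the $\Bbbk$-module of all sequences $s=(s_0,s_1,\dots)$ of elements of $\Bbbk$ with termwise operations. For $s\in\mathfrak{S}_\Bbbk$ and $q(x)=\sum_i c_ix^i\in\Bbbk[x]$ put $\langle s,q\rangle=\sum_i c_i s_i$. The divided derivatives $\delta^m:\Bbbk[x]\to\Bbbk[x]$ are defined by $q(x+y)=\sum_{m\ge 0}(\delta^m q)(x)\,y^m$ in $\Bbbk[x,y]$. $D^m:\mathfrak{S}_\Bbbk\to\mathfrak{S}_\Bbbk$ is the unique map with $\langle D^m(s),q\rangle=\langle s,\delta^m(q)\rangle$ for all $s,q$. $L$ is the left shift $(Ls)_i=s_{i+1}$, and $p(L)=L^n+c_1L^{n-1}+\dots+c_n\,\mathrm{id}$. For $\alpha\in\Bbbk$, $s(\alpha)_i=\alpha^i$ (with $\alpha^0=1$) and $s(\alpha,m)=D^m(s(\alpha))$.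 *)

(* Defs.v *)
From HB Require Import structures.
From mathcomp Require Import all_boot all_order all_algebra.
From mathcomp Require Import boolp classical_sets functions.

Set Implicit Arguments.
Unset Strict Implicit.
Unset Printing Implicit Defensive.

Import GRing.Theory.
Local Open Scope ring_scope.

(* The carrier is R^o so that sequences inherit the pointwise lmodType R
   structure on functions. *)
Notation kseq R := (nat -> R^o).

Section Sequences.
Variable R : comNzRingType.
Implicit Types (s t : kseq R) (p q : {poly R}).

Definition pairing s q : R := \sum_(i < size q) q`_i * s i.

(* poly_XaY q is q('X + 'Y) in {poly {poly R}}, whose coefficients with respect
   to the outer variable are polynomials in the inner one. *)
Definition divderiv (m : nat) q : {poly R} := (poly_XaY q)`_m.

(* The formula is forced by <D^m(s), q> = <s, delta^m(q)> at q = 'X^i; see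
   pairing_seqD and seqD_unique. *)
Definition seqD (m : nat) s : kseq R := fun i => pairing s (divderiv m 'X^i).

Definition shiftL s : kseq R := fun i => s i.+1.

Definition evalL p s : kseq R := \sum_(i < size p) p`_i *: iter i shiftL s.

Definition kerL p : set (kseq R) := [set s | evalL p s = 0]%classic.

Definition geomseq (x : R) : kseq R := fun i => x ^+ i.

Definition geomseqD (x : R) (m : nat) : kseq R := seqD m (geomseq x).

Lemma pairing_widen s q n : (size q <= n)%N ->
  pairing s q = \sum_(i < n) q`_i * s i.
Proof.
move=> le_qn; rewrite /pairing (big_ord_widen _ (fun i => q`_i * s i) le_qn).
rewrite big_mkcond; apply: eq_bigr => i _; case: ltnP => // le_qi.
by rewrite nth_default ?mul0r.
Qed.

Lemma pairingP s a p q : pairing s (a *: p + q) = a * pairing s p + pairing s q.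
Proof.
set n := maxn (size (a *: p + q)) (maxn (size p) (size q)).
rewrite !(@pairing_widen s _ n) ?leq_max ?leqnn ?orbT //.
rewrite mulr_sumr -big_split /=; apply: eq_bigr => i _.
by rewrite coefD coefZ mulrDl mulrA.
Qed.

Lemma pairingXn s i : pairing s 'X^i = s i.
Proof.
rewrite /pairing size_polyXn big_ord_recr /= big1 ?add0r => [|j _].
  by rewrite coefXn eqxx mul1r.
by rewrite coefXn ltn_eqF ?mul0r.
Qed.

Lemma divderivP m a p q :
  divderiv m (a *: p + q) = a *: divderiv m p + divderiv m q.
Proof.
rewrite /divderiv /poly_XaY rmorphD /= map_polyZ comp_polyD comp_polyZ.
by rewrite coefD coefZ mul_polyC.
Qed.

Lemma divderivE m q : divderiv m q = q^`N(m).
Proof.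
rewrite /divderiv.
have -> : poly_XaY q = \poly_(i < size q) q^`N(i).
  have cXY : GRing.comm ('X%:P : {poly {poly R}}) 'X by exact: mulrC.
  rewrite /poly_XaY poly_def addrC /comp_poly (nderiv_taylor _ cXY).
  rewrite !size_map_polyC; apply: eq_bigr => i _.
  by rewrite !nderivn_map horner_map -/(comp_poly _ _) comp_polyXr mul_polyC.
rewrite coef_poly; case: ltnP => // le_qm.
by apply/esym/nderivn_poly0.
Qed.

Lemma pairing_seqD m s q : pairing (seqD m s) q = pairing s (divderiv m q).
Proof.
have pD (I : Type) (r : seq I) (c : I -> R) (f : I -> {poly R}) :
    pairing s (divderiv m (\sum_(i <- r) c i *: f i))
    = \sum_(i <- r) c i * pairing s (divderiv m (f i)).
  elim: r => [|i r IHr]; last by rewrite !big_cons divderivP pairingP IHr.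
  rewrite !big_nil /divderiv /poly_XaY rmorph0 comp_poly0 coef0.
  by rewrite /pairing size_poly0 big_ord0.
by rewrite -[q in RHS]coefK poly_def pD.
Qed.

Lemma seqD_unique m (F : kseq R -> kseq R) :
  (forall s q, pairing (F s) q = pairing s (divderiv m q)) -> F = seqD m.
Proof.
by move=> FE; apply/funext => s; apply/funext => i; rewrite -pairingXn FE.
Qed.

End Sequences.

(* The finitely indexed family e freely generates the submodule M: every
   element of M has a unique coordinate vector with respect to e. *)
Definition free_generators (R : nzRingType) (V : lmodType R) (I : finType)
    (e : I -> V) (M : set V) : Prop :=
  [/\ GRing.submod_closed (mem M),
      forall i, M (e i) &
      forall v, M v -> exists! c : {ffun I -> R}, v = \sum_i c i *: e i].

(* Main.v *)
Require Import Defs.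
From HB Require Import structures.
From mathcomp Require Import all_boot all_order all_algebra.
From mathcomp Require Import boolp classical_sets functions.

Set Implicit Arguments.
Unset Strict Implicit.
Unset Printing Implicit Defensive.

Import GRing.Theory.
Local Open Scope ring_scope.
Local Open Scope classical_set_scope.

(** Pairing [s(x, m)] with a polynomial [q] gives the [m]-th Taylor coefficient
    of [q] at [x], which vanishes as soon as [('X - x) ^+ n] divides [q] for some
    [n > m]. Since [(p(L) s)_i] is the pairing of [s] with [p * 'X^i], the
    generators lie in [Ker p(L)]. For independence, a vanishing combination with
    coefficients [c] is paired with
    [('X - alpha_u) ^+ b * \prod_(v != u) ('X - alpha_v) ^+ mu_v]: this kills all
    the terms except those with root [alpha_u] and index [a >= b], and the term
    [a = b] is multiplied by [\prod_(v != u) (alpha_u - alpha_v) ^+ mu_v != 0];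
    descending induction on [b] gives [c = 0]. *)

Section TaylorCoefficients.
Variable R : comNzRingType.
Implicit Types (x : R) (p q g : {poly R}) (s : kseq R).

(** Taylor's formula at the commuting elements [x%:P] and ['X] expands the translate of [q] in
    powers of ['X]. *)
Lemma coef_comp_polyXaddC q x m : (q \Po ('X + x%:P))`_m = q^`N(m).[x].
Proof.
have cxX : GRing.comm (x%:P : {poly R}) 'X by exact: mulrC.
rewrite addrC /comp_poly (nderiv_taylor _ cxX) size_map_polyC.
under eq_bigr => i _ do rewrite nderivn_map horner_map mul_polyC.
rewrite -(poly_def _ (fun i => q^`N(i).[x])) coef_poly.
by case: ltnP => // le_qm; rewrite nderivn_poly0 ?horner0.
Qed.

(** Translation by [x] turns [('X - x%:P) ^+ n] into ['X^n], which only shifts the coefficients by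
    [n]. *)
Lemma nderivn_XsubC_exp_mul x n g m :
  (('X - x%:P) ^+ n * g)^`N(m).[x] =
  if (m < n)%N then 0 else g^`N(m - n).[x].
Proof.
rewrite -!coef_comp_polyXaddC comp_polyM rmorphXn /= comp_polyB comp_polyX.
by rewrite comp_polyC addrK mulrC coefMXn.
Qed.

Lemma pairing_geomseq x q : pairing (geomseq x) q = q.[x].
Proof. by rewrite horner_coef. Qed.

Lemma pairing_geomseqD x m q : pairing (geomseqD x m) q = q^`N(m).[x].
Proof. by rewrite pairing_seqD pairing_geomseq divderivE. Qed.

Lemma iter_shiftL n s i : iter n (@shiftL R) s i = s (n + i)%N.
Proof. by elim: n i => //= n IHn i; rewrite /shiftL IHn addnS. Qed.

Lemma evalLE p s i : evalL p s i = pairing s (p * 'X^i).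
Proof.
have le_p : (size (p * 'X^i)%R <= i + size p)%N.
  by rewrite (leq_trans (size_polyMleq _ _)) // size_polyXn addnS addnC.
(* The sum is cut at [i]: below it the coefficients of [p * 'X^i] vanish, above it they are those of
   [p]. *)
rewrite (pairing_widen s le_p) big_split_ord /= big1 ?add0r => [|j _]; last first.
  by rewrite coefMXn ltn_ord mul0r.
rewrite /evalL fct_sumE; apply: eq_bigr => j _.
by rewrite coefMXn ltnNge leq_addr addKn addnC /= -iter_shiftL.
Qed.

Lemma geomseqD_kerL x n g m :
  (m < n)%N -> kerL (('X - x%:P) ^+ n * g) (geomseqD x m).
Proof.
move=> lt_mn; apply/funext => i.
by rewrite evalLE pairing_geomseqD -mulrA nderivn_XsubC_exp_mul lt_mn.
Qed.

Lemma pairing0 q : pairing (0 : kseq R) q = 0.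
Proof. by rewrite /pairing big1 // => i _; rewrite mulr0. Qed.

Lemma pairing_sum (I : finType) (c : I -> R) (e : I -> kseq R) q :
  pairing (\sum_i c i *: e i) q = \sum_i c i * pairing (e i) q.
Proof.
under [RHS]eq_bigr => i _ do rewrite mulr_sumr.
rewrite exchange_big; apply: eq_bigr => j _ /=.
rewrite fct_sumE mulr_sumr; apply: eq_bigr => i _.
by rewrite mulrCA.
Qed.

Lemma kerL_sum (I : finType) (c : I -> R) (e : I -> kseq R) p :
  (forall i, kerL p (e i)) -> kerL p (\sum_i c i *: e i).
Proof.
move=> ker_e; apply/funext => j; rewrite evalLE pairing_sum big1 // => i _.
by rewrite -evalLE ker_e mulr0.
Qed.

End TaylorCoefficients.

Section Span.
Variables (R : nzRingType) (V : lmodType R) (I : finType) (e : I -> V).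

Definition span_of : set V :=
  [set v | exists c : {ffun I -> R}, v = \sum_i c i *: e i].

(** Coordinates exist by the choice of the span; two coordinate vectors of one element differ by a
    relation, hence agree. *)
Lemma free_generators_span :
  (forall c : {ffun I -> R}, \sum_i c i *: e i = 0 -> c = 0) ->
  free_generators e span_of.
Proof.
move=> free_e; split.
- split=> [|a v w /set_mem[c ->] /set_mem[d ->]]; apply/mem_set.
    by exists 0; rewrite big1 // => i _; rewrite ffunE scale0r.
  exists [ffun i => a * c i + d i].
  rewrite scaler_sumr -big_split; apply: eq_bigr => i _.
  by rewrite ffunE scalerDl scalerA.
- move=> i; exists [ffun j => (j == i)%:R].
  rewrite (bigD1 i) //= ffunE eqxx scale1r big1 ?addr0 // => j /negPf ji.
  by rewrite ffunE ji scale0r.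
- move=> v [c vc]; exists c; split=> // d vd; apply/subr0_eq/free_e.
  under eq_bigr => i _ do rewrite !ffunE scalerBl.
  by rewrite sumrB -vc -vd subrr.
Qed.

End Span.

Section Independence.
Variables (R : idomainType) (k : nat) (alpha : 'I_k -> R) (mu : 'I_k -> nat).
Hypothesis alpha_inj : injective alpha.

Let other_roots (u : 'I_k) : {poly R} :=
  \prod_(v < k | v != u) ('X - (alpha v)%:P) ^+ mu v.

Lemma other_roots_neq0 u : (other_roots u).[alpha u] != 0.
Proof.
rewrite horner_prod; apply/prodf_neq0 => v v_neq_u.
by rewrite horner_exp !hornerE expf_neq0 // subr_eq0 (inj_eq alpha_inj) eq_sym.
Qed.

Lemma nderivn_other_roots_neq u v m g : v != u -> (m < mu v)%N ->
  (g * other_roots u)^`N(m).[alpha v] = 0.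
Proof.
move=> v_neq_u lt_m.
by rewrite /other_roots (bigD1 v) //= mulrCA nderivn_XsubC_exp_mul lt_m.
Qed.

Lemma geomseqD_free (c : {ffun {u : 'I_k & 'I_(mu u)} -> R}) :
  \sum_i c i *: geomseqD (alpha (tag i)) (tagged i) = 0 -> c = 0.
Proof.
move=> c_rel; apply/ffunP => -[u b]; rewrite ffunE.
(* Induction on a bound for [mu u - b], with [u] fixed, is the descending induction on [b]. *)
have [n] := ubnP (mu u - b); elim: n b => // n IHn b lt_n.
pose q := ('X - (alpha u)%:P) ^+ b * other_roots u.
have := congr1 (fun s => pairing s q) c_rel.
rewrite pairing_sum (bigD1 (Tagged (fun u => 'I_(mu u)) b)) //= big1 => [|[v a]].
  rewrite addr0 pairing_geomseqD nderivn_XsubC_exp_mul ltnn subnn nderivn0.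
  rewrite pairing0 => /eqP.
  by rewrite mulf_eq0 (negPf (other_roots_neq0 u)) orbF => /eqP.
(* The index [a] is generalized because its type ['I_(mu v)] depends on [v]. *)
rewrite pairing_geomseqD /=; case: (eqVneq v u) a => [->|v_neq_u] a; last first.
  by rewrite nderivn_other_roots_neq ?mulr0.
rewrite eq_Tagged /= => a_neq_b.
rewrite nderivn_XsubC_exp_mul; case: ltnP => [|le_ba]; first by rewrite mulr0.
have lt_ba : (b < a)%N by rewrite ltn_neqAle eq_sym a_neq_b.
(* Subtraction is truncated, so [mu u - a < mu u - b] also uses [b < mu u]. *)
rewrite IHn ?mul0r //; apply: leq_trans (ltn_sub2l (ltn_ord b) lt_ba) _.
by rewrite -ltnS.
Qed.

End Independence.

Theorem theorem7p4 (R : idomainType) (p : {poly R}) (k : nat)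
    (alpha : 'I_k -> R) (mu : 'I_k -> nat)
    (p_monic : p \is monic)
    (alpha_inj : injective alpha)
    (mu_gt0 : forall u, (1 <= mu u)%N)
    (p_split : p = \prod_(u < k) ('X - (alpha u)%:P) ^+ mu u) :
  exists M : set (kseq R),
    M `<=` kerL p /\
    free_generators
      (fun i : {u : 'I_k & 'I_(mu u)} => geomseqD (alpha (tag i)) (tagged i))
      M.
Proof.
(* The witness [M], left open here, is unified with the span of the family. *)
eexists; split; last exact/free_generators_span/(geomseqD_free alpha_inj).
move=> _ [c ->]; apply: kerL_sum => -[u a] /=.
by rewrite p_split (bigD1 u) //=; apply: geomseqD_kerL.
Qed.
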